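(* Consider a general POVM attack on single-photon SARG04: Eve uses a POVM $\{M_{\mathrm{vac}},M_0,\dots,M_{J-1}\}$ on $\mathbb{C}^2$ (positive operators with $M_{\mathrm{vac}}+\sum_iM_i=I$, $J$ arbitrary) and, on outcome $i$, sends Bob an arbitrary qubit state $|\sigma_i\rangle$ (on outcome vac she sends nothing). The resulting unnormalized state of Alice and Bob is $$\rho_{AB}=\sum_{k=0}^{3}\sum_{i=0}^{J-1}\operatorname{Tr}_{E}\!\Big[(I_A\otimes M_i)(I_A\otimes R^k)|\Psi\rangle\langle\Psi|(I_A\otimes R^{-k})\Big]\otimes F R^{-k}|\sigma_i\rangle\langle\sigma_i|R^{k}F^\dagger,$$ with $|\Psi\rangle=|0_z\rangle_A|\varphi_0\rangle_E+|1_z\rangle_A|\varphi_1\rangle_E$, and the induced bit error rate (defined when $\operatorname{Tr}\rho_{AB}>0$) is $$e_b=\frac{\langle0_z1_z|\rho_{AB}|0_z1_z\rangle+\langle1_z0_z|\rho_{AB}|1_z0_z\rangle}{\operatorname{Tr}\rho_{AB}}.$$ Then the smallest bit error rate $e_b$ that Eve can induce by such an attack is $\tfrac13$.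
   Context: Qubits use bases related by $|0_x\rangle=(|0_z\rangle+|1_z\rangle)/\sqrt2$, $|1_x\rangle=(|0_z\rangle-|1_z\rangle)/\sqrt2$. Let $|\varphi_0\rangle=\cos(\pi/8)|0_x\rangle+\sin(\pi/8)|1_x\rangle$, $R=\cos(\pi/4)I+\sin(\pi/4)(|1_x\rangle\langle0_x|-|0_x\rangle\langle1_x|)$, $|\varphi_m\rangle=R^{-m}|\varphi_0\rangle$ (indices mod 4), and $F=\sin(\pi/8)|0_x\rangle\langle0_x|+\cos(\pi/8)|1_x\rangle\langle1_x|$ (Bob's successful filtering, i.e. conclusive result). Alice applies the random rotation $R^k$, $k\in\{0,1,2,3\}$ uniformly, to the transmitted qubit; Bob applies $R^{-k}$ then $F$. $\operatorname{Tr}_E$ is the partial trace over the transmitted qubit. *)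

(* Defs.v *)
From HB Require Import structures.
From mathcomp Require Import all_boot all_order all_algebra.
From mathcomp Require Import reals trigo.
From mathcomp Require Import complex mxtens.
Set Implicit Arguments. Unset Strict Implicit. Unset Printing Implicit Defensive.
Import Order.TTheory GRing.Theory Num.Theory.
Local Open Scope ring_scope.
Local Open Scope complex_scope.

Section SARG04.
Variable R : realType.
Local Notation C := (R[i]).

Definition dag {m n} (A : 'M[C]_(m, n)) : 'M[C]_(n, m) := (map_mx conjc A)^T.

Definition rc (x : R) : C := x%:C.

Definition ket0z : 'cV[C]_2 := delta_mx 0 0.
Definition ket1z : 'cV[C]_2 := delta_mx 1 0.
Definition ket0x : 'cV[C]_2 := rc (Num.sqrt 2)^-1 *: (ket0z + ket1z).
Definition ket1x : 'cV[C]_2 := rc (Num.sqrt 2)^-1 *: (ket0z - ket1z).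

Definition phi0 : 'cV[C]_2 :=
  rc (cos (pi / 8)) *: ket0x + rc (sin (pi / 8)) *: ket1x.

Definition Rot : 'M[C]_2 :=
  rc (cos (pi / 4)) *: 1%:M
  + rc (sin (pi / 4)) *: (ket1x *m dag ket0x - ket0x *m dag ket1x).

Definition phi (m : nat) : 'cV[C]_2 := (Rot ^- m) *m phi0.

Definition Filt : 'M[C]_2 :=
  rc (sin (pi / 8)) *: (ket0x *m dag ket0x)
  + rc (cos (pi / 8)) *: (ket1x *m dag ket1x).

Definition Psi : 'cV[C]_(2 * 2) := ket0z *t phi0 + ket1z *t phi 1.

Definition ptrE (X : 'M[C]_(2 * 2)) : 'M[C]_2 :=
  \matrix_(a, b) \sum_(e < 2) X (mxtens_index (a, e)) (mxtens_index (b, e)).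

Definition psd (A : 'M[C]_2) : Prop :=
  forall v : 'cV[C]_2, 0 <= (dag v *m A *m v) 0 0.

Definition is_state (v : 'cV[C]_2) : Prop := (dag v *m v) 0 0 = 1.

Definition is_povm (J : nat) (Mvac : 'M[C]_2) (M : 'I_J -> 'M[C]_2) : Prop :=
  psd Mvac /\ (forall i, psd (M i)) /\ Mvac + \sum_(i < J) M i = 1%:M.

Definition rhoAB (J : nat) (M : 'I_J -> 'M[C]_2) (sigma : 'I_J -> 'cV[C]_2)
  : 'M[C]_(2 * 2) :=
  \sum_(k < 4) \sum_(i < J)
    ptrE ((1%:M *t M i) *m (1%:M *t Rot ^+ k) *m (Psi *m dag Psi)
          *m (1%:M *t Rot ^- k))
    *t (Filt *m Rot ^- k *m (sigma i *m dag (sigma i)) *m Rot ^+ k *m dag Filt).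

Definition ebit (rho : 'M[C]_(2 * 2)) : C :=
  ((dag (ket0z *t ket1z) *m rho *m (ket0z *t ket1z)) 0 0
   + (dag (ket1z *t ket0z) *m rho *m (ket1z *t ket0z)) 0 0) / \tr rho.

End SARG04.

(* Main.v *)
(* Everything in the protocol except Eve's M_i and sigma_i is real, so averaging
   over the four rotations leaves only the components of their Bloch vectors in
   the real plane.  With t_i = Tr M_i / 2 and x_i the inner product of these
   components of M_i and sigma_i, the error weight is the sum of 2 t_i - x_i and
   the trace is the sum of 4 t_i - x_i.  Three times the former minus the latter
   is the sum of 2 (t_i - x_i), which is nonnegative because M_i is positive;
   x_i = t_i for the projector on |0z> resent as |0z>, hence equality. *)
Require Import Defs.
From HB Require Import structures.
From mathcomp Require Import all_boot all_order all_algebra.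
From mathcomp Require Import reals trigo.
From mathcomp Require Import complex mxtens ring lra zify.
Import Order.TTheory GRing.Theory Num.Theory.
Local Open Scope ring_scope.
Set Implicit Arguments.
Unset Strict Implicit.
Unset Printing Implicit Defensive.

(** * Coordinates in dimension two *)

Lemma ord2P (P : 'I_2 -> Prop) : P 0 -> P 1 -> forall i, P i.
Proof.
move=> P0 P1 [[|[|//]] lti].
  by have -> : Ordinal lti = 0 by apply: val_inj.
by have -> : Ordinal lti = 1 by apply: val_inj.
Qed.

Lemma sum_ord2 (V : nmodType) (f : 'I_2 -> V) : \sum_i f i = f 0 + f 1.
Proof. by rewrite big_ord_recl big_ord1; congr (_ + f _); apply: val_inj. Qed.

Lemma sum_ord4 (V : nmodType) (f : nat -> V) :
  \sum_(k < 4) f k = f 0%N + f 1%N + f 2%N + f 3%N.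
Proof. by rewrite !big_ord_recl big_ord0 addr0 !addrA. Qed.

Section Dimension2.
Context {T : comUnitRingType}.
Implicit Types (a b c d x y : T).

Definition col2 x y : 'cV[T]_2 := \col_i (if i == 0 then x else y).

Definition mx2 a b c d : 'M[T]_2 :=
  \matrix_(i, j) if i == 0 then (if j == 0 then a else b)
                 else (if j == 0 then c else d).

Lemma col2E x y : (col2 x y 0 0 = x) * (col2 x y 1 0 = y).
Proof. by rewrite !mxE. Qed.

Lemma mx2E a b c d :
  (mx2 a b c d 0 0 = a) * (mx2 a b c d 0 1 = b) *
  (mx2 a b c d 1 0 = c) * (mx2 a b c d 1 1 = d).
Proof. by rewrite !mxE. Qed.

Lemma mul_mx2 a b c d a' b' c' d' :
  mx2 a b c d * mx2 a' b' c' d' =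
  mx2 (a * a' + b * c') (a * b' + b * d') (c * a' + d * c') (c * b' + d * d').
Proof.
by apply/matrixP; apply: ord2P; apply: ord2P; rewrite !mxE sum_ord2 !mxE.
Qed.

Lemma mul_mx2_col2 a b c d x y :
  mx2 a b c d *m col2 x y = col2 (a * x + b * y) (c * x + d * y).
Proof.
by apply/matrixP; apply: ord2P => i; rewrite !mxE sum_ord2 !mxE.
Qed.

Lemma mx2_1 : mx2 1 0 0 1 = 1.
Proof. by apply/matrixP; apply: ord2P; apply: ord2P; rewrite !mxE. Qed.

End Dimension2.

(** * The angle pi/4 *)

Section Trigonometry.
Variable R : realType.

(** The double angle formula at pi/2 fixes the square; positivity of the cosine selects the root. *)
Lemma cos_pi4 : cos (pi / 4) = (Num.sqrt 2)^-1 :> R.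
Proof.
have pi0 : 0 < pi :> R by exact: pi_gt0.
have c0 : 0 < cos (pi / 4) :> R by apply: cos_gt0_pihalf; apply/andP; split; lra.
have : cos (pi / 4 *+ 2) = 0 :> R.
  by rewrite -(cos_pihalf R); congr cos; field.
rewrite cos_mulr2n => /eqP; rewrite subr_eq0 -mulr_natr => /eqP c2.
have /eqP : (cos (pi / 4) * Num.sqrt 2) ^+ 2 = 1 :> R by rewrite exprMn sqr_sqrtr.
rewrite sqrf_eq1 => /orP[]/eqP cE.
  by rewrite -[LHS](mulfK (_ : Num.sqrt 2 != 0)) ?cE ?mul1r // gt_eqF ?sqrtr_gt0.
have : 0 <= cos (pi / 4) * Num.sqrt 2 :> R by rewrite mulr_ge0 ?sqrtr_ge0 // ltW.
by rewrite cE; lra.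
Qed.

Lemma sin_pi4 : sin (pi / 4) = (Num.sqrt 2)^-1 :> R.
Proof.
have -> : pi / 4 = - (pi / 4 - pi / 2) :> R by field.
by rewrite sinN sinBpihalf opprK cos_pi4.
Qed.

End Trigonometry.

(** * Protocol vectors and operators in the z basis *)

Section Attack.
Variable R : realType.
Local Notation C := R[i].

Definition sqrt2V : C := rc (Num.sqrt 2)^-1.
Definition cos8 : C := rc (cos (pi / 8)).
Definition sin8 : C := rc (sin (pi / 8)).
Local Notation h := sqrt2V.
Local Notation c := cos8.
Local Notation s := sin8.

Lemma rcM (x y : R) : rc (x * y) = rc x * rc y. Proof. exact: rmorphM. Qed.
Lemma rcD (x y : R) : rc (x + y) = rc x + rc y. Proof. exact: rmorphD. Qed.
Lemma rcB (x y : R) : rc (x - y) = rc x - rc y. Proof. exact: rmorphB. Qed.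
Lemma rc_nat n : rc n%:R = n%:R :> C. Proof. exact: rmorph_nat. Qed.

Lemma mul2_sqrt2V_sqr : 2 * (h * h) = 1.
Proof.
rewrite /sqrt2V -rcM -invfM -expr2 sqr_sqrtr // -(rc_nat 2) -rcM.
by rewrite divff ?pnatr_eq0.
Qed.

Lemma cos8_sqrDsin8_sqr : c * c + s * s = 1.
Proof. by rewrite /cos8 /sin8 -!rcM -rcD -!expr2 cos2Dsin2. Qed.

Let pi84 : pi / 8 + pi / 8 = pi / 4 :> R. Proof. by field. Qed.

Lemma cos8_sqrBsin8_sqr : c * c - s * s = h.
Proof. by rewrite /cos8 /sin8 /sqrt2V -!rcM -rcB -cosD pi84 cos_pi4. Qed.

Lemma mul2_cos8_sin8 : 2 * (c * s) = h.
Proof.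
rewrite /cos8 /sin8 /sqrt2V -!rcM -(rc_nat 2) -rcM -sin_pi4 -pi84 sinD.
by congr rc; ring.
Qed.

Lemma conj_rc (x : R) : conjc (rc x) = rc x :> C.
Proof. exact: conjc_real. Qed.

Lemma conj_sqrt2V : conjc h = h. Proof. exact: conj_rc. Qed.
Lemma conj_cos8 : conjc c = c. Proof. exact: conj_rc. Qed.
Lemma conj_sin8 : conjc s = s. Proof. exact: conj_rc. Qed.
Lemma conjN (x : C) : conjc (- x) = - conjc x. Proof. exact: rmorphN. Qed.
Lemma conjD (x y : C) : conjc (x + y) = conjc x + conjc y.
Proof. exact: rmorphD. Qed.
Lemma conjM (x y : C) : conjc (x * y) = conjc x * conjc y.
Proof. exact: rmorphM. Qed.

Lemma dag_col2 (x y : C) :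
  dag (col2 x y) = \row_j (if j == 0 then conjc x else conjc y).
Proof. by apply/matrixP => i; apply: ord2P; rewrite !mxE. Qed.

Lemma dag_mx2 (x y z w : C) :
  dag (mx2 x y z w) = mx2 (conjc x) (conjc z) (conjc y) (conjc w).
Proof. by apply/matrixP; apply: ord2P; apply: ord2P; rewrite !mxE. Qed.

Lemma ket0zE : ket0z R = col2 1 0.
Proof. by apply/matrixP; apply: ord2P => i; rewrite ord1 !mxE. Qed.

Lemma ket1zE : ket1z R = col2 0 1.
Proof. by apply/matrixP; apply: ord2P => i; rewrite ord1 !mxE. Qed.

Lemma ket0xE : ket0x R = col2 h h.
Proof.
rewrite /ket0x -/sqrt2V ket0zE ket1zE.
by apply/matrixP; apply: ord2P => i; rewrite ord1 !mxE /=; ring.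
Qed.

Lemma ket1xE : ket1x R = col2 h (- h).
Proof.
rewrite /ket1x -/sqrt2V ket0zE ket1zE.
by apply/matrixP; apply: ord2P => i; rewrite ord1 !mxE /=; ring.
Qed.

(** The change from the x to the z basis is a reflection, so the counterclockwise rotation by pi/4
    becomes a clockwise one. *)
Lemma RotE : Rot R = mx2 h h (- h) h.
Proof.
rewrite /Rot cos_pi4 sin_pi4 -/sqrt2V ket0xE ket1xE !dag_col2 conjN !conj_sqrt2V.
by apply/matrixP; apply: ord2P; apply: ord2P;
  rewrite !mxE !big_ord1 !mxE /=;
  solve [ring | rewrite -[RHS]mulr1 -mul2_sqrt2V_sqr; ring].
Qed.

Lemma RotVE : (Rot R)^-1 = mx2 h (- h) h h.
Proof.
have e : Rot R * mx2 h (- h) h h = 1.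
  by rewrite RotE mul_mx2 -mx2_1; congr mx2; ring: mul2_sqrt2V_sqr.
have [u _] := mulmx1_unit e.
by rewrite -[RHS](mulKr u) e mulr1.
Qed.

(** Half-angle formulas with [h * h] in place of 1/2: quadratic monomials in [c] and [s] become
    polynomials in [h], with no division. *)
Lemma cos8_sin8_quadratic :
  [/\ c * c = h * h * (1 + h), s * s = h * h * (1 - h),
  c * s = h * h * h & 2 * (h * h) = 1].
Proof.
have e1 := mul2_sqrt2V_sqr; have e2 := cos8_sqrDsin8_sqr.
have e3 := cos8_sqrBsin8_sqr; have e4 := mul2_cos8_sin8.
split=> //; rewrite -[LHS]mul1r -[in LHS]e1.
- by transitivity (h * h * (c * c + s * s + (c * c - s * s)));
    [ring | rewrite e2 e3].
- by transitivity (h * h * (c * c + s * s - (c * c - s * s)));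
    [ring | rewrite e2 e3].
- by transitivity (h * h * (2 * (c * s))); [ring | rewrite e4].
Qed.

(** Subtraction formula for pi/8 = pi/4 - pi/8, reading one [h] as a cosine and the other as a sine.
    Together with [sin8E] it says that the Hadamard matrix fixes [(c, s)]. *)
Lemma cos8E : h * c + h * s = c.
Proof.
rewrite {1}/sqrt2V -{1}cos_pi4 /sqrt2V -sin_pi4 -!rcM -rcD -cosB.
by congr (rc (cos _)); field.
Qed.

Lemma sin8E : h * c - h * s = s.
Proof.
rewrite {1}/sqrt2V -sin_pi4 /sqrt2V -cos_pi4 -!rcM -rcB -sinB.
by congr (rc (sin _)); field.
Qed.

Lemma phi0E : phi0 R = col2 c s.
Proof.
rewrite /phi0 -/cos8 -/sin8 ket0xE ket1xE; apply/matrixP; apply: ord2P => i.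
  by rewrite ord1 !mxE /= -[RHS]cos8E; ring.
by rewrite ord1 !mxE /= -[RHS]sin8E; ring.
Qed.

Lemma phi1E : phi R 1 = col2 s c.
Proof.
rewrite /phi expr1 RotVE phi0E mul_mx2_col2.
by congr col2; [rewrite -[RHS]sin8E|rewrite -[RHS]cos8E]; ring.
Qed.

(** Up to [h], row 0 is orthogonal to [phi R 1] and row 1 to [phi0 R]: each of Bob's results
    excludes the state of the other bit. *)
Lemma FiltE : Filt R = mx2 (h * c) (- (h * s)) (- (h * s)) (h * c).
Proof.
rewrite /Filt -/cos8 -/sin8 ket0xE ket1xE !dag_col2 conjN !conj_sqrt2V.
apply/matrixP; apply: ord2P; apply: ord2P;
  rewrite !mxE !big_ord1 !mxE /=;
  solve [rewrite -[in RHS]sin8E; ring | rewrite -[in RHS]cos8E; ring].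
Qed.

(** * Tensor products, adjoints and the partial trace *)

Lemma tens_diag_trace (T : pzRingType) (A : 'M[T]_(2 * 2)) :
  \tr A = \sum_a \sum_b A (mxtens_index (a, b)) (mxtens_index (a, b)).
Proof.
rewrite !sum_ord2 /mxtrace !big_ord_recl big_ord0 addr0 !addrA.
by congr (A _ _ + A _ _ + A _ _ + A _ _); apply: val_inj.
Qed.

Lemma ord1_tens (j : 'I_(1 * 1)) : j = mxtens_index (0, 0).
Proof. by apply: val_inj; case: j => -[]. Qed.

Lemma ket_tens (a b : 'I_2) :
  (delta_mx a 0 : 'cV[C]_2) *t (delta_mx b 0 : 'cV[C]_2) =
  delta_mx (mxtens_index (a, b)) 0.
Proof.
apply/matrixP => i j; rewrite -(@mxtens_unindexK 2 2 i).
case: (mxtens_unindex _) => i1 i2.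
rewrite [j]ord1_tens tensmxE !mxE.
rewrite (can_eq (@mxtens_indexK 2 2)) xpair_eqE.
by rewrite -natrM mulnb !ord1 !eqxx !andbT.
Qed.

Lemma braket_delta n (A : 'M[C]_n) (i : 'I_n) :
  (dag (delta_mx i 0 : 'cV[C]_n) *m A *m (delta_mx i 0 : 'cV[C]_n)) 0 0 = A i i.
Proof.
have -> : dag (delta_mx i 0 : 'cV[C]_n) = delta_mx 0 i.
  by apply/matrixP => k l; rewrite !mxE conjc_nat andbC.
by rewrite -colE -rowE !mxE.
Qed.

Lemma dag_tens m n p q (A : 'M[C]_(m, n)) (B : 'M[C]_(p, q)) :
  dag (A *t B) = dag A *t dag B.
Proof. by rewrite /dag map_mxT trmx_tens. Qed.

Lemma dagD m n (A B : 'M[C]_(m, n)) : dag (A + B) = dag A + dag B.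
Proof. by rewrite /dag map_mxD linearD. Qed.

Lemma dagM m n p (A : 'M[C]_(m, n)) (B : 'M[C]_(n, p)) :
  dag (A *m B) = dag B *m dag A.
Proof. by rewrite /dag map_mxM trmx_mul. Qed.

(** A tensor product of columns has [1 * 1] columns. This and the next four lemmas state the general
    rules at the convertible dimension [1], so that they rewrite expressions in [Psi]. *)
Lemma tens_mul_col m n p q (A : 'M[C]_(m, n)) (B : 'M[C]_(p, q))
    (u : 'cV_n) (v : 'cV_q) :
  (A *t B) *m (u *t v : 'cV_(n * q)) = (A *m u) *t (B *m v) :> 'cV_(m * p).
Proof. exact: (tensmx_mul A B u v). Qed.

Lemma tens_mul_row m n p q (A : 'M[C]_(m, n)) (B : 'M[C]_(p, q))
    (u : 'rV_m) (v : 'rV_p) :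
  (u *t v : 'rV_(m * p)) *m (A *t B) = (u *m A) *t (v *m B) :> 'rV_(n * q).
Proof. exact: (tensmx_mul u v A B). Qed.

Lemma dag_tens_col m n (u : 'cV[C]_m) (v : 'cV[C]_n) :
  dag (u *t v : 'cV_(m * n)) = dag u *t dag v :> 'rV_(m * n).
Proof. exact: (dag_tens u v). Qed.

Lemma tens_colE m n (u : 'cV[C]_m) (v : 'cV[C]_n) i j k :
  (u *t v : 'cV_(m * n)) (mxtens_index (i, j)) k = u i 0 * v j 0.
Proof. by rewrite [k]ord1_tens; exact: (tensmxE u v). Qed.

Lemma tens_rowE m n (u : 'rV[C]_m) (v : 'rV[C]_n) i j k :
  (u *t v : 'rV_(m * n)) k (mxtens_index (i, j)) = u 0 i * v 0 j.
Proof. by rewrite [k]ord1_tens; exact: (tensmxE u v). Qed.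

Lemma phi_0E : phi R 0 = phi0 R.
Proof. by rewrite /phi expr0 invr1 mul1mx. Qed.

Lemma tens_Psi (A : 'M[C]_2) (a e : 'I_2) j :
  ((1%:M *t A) *m Psi R) (mxtens_index (a, e)) j = (A *m phi R a) e 0.
Proof.
rewrite /Psi mulmxDr !tens_mul_col !mul1mx mxE !tens_colE.
rewrite [ket0z R _ _]mxE [ket1z R _ _]mxE !eqxx !andbT.
move: a; apply: ord2P => /=; rewrite mul1r mul0r.
  by rewrite addr0 phi_0E.
by rewrite add0r.
Qed.

Lemma Psi_tens (B : 'M[C]_2) (a e : 'I_2) i :
  (dag (Psi R) *m (1%:M *t B)) i (mxtens_index (a, e)) =
  (dag (phi R a) *m B) 0 e.
Proof.
rewrite /Psi dagD !dag_tens_col mulmxDl !tens_mul_row !mulmx1 mxE !tens_rowE.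
rewrite ket0zE ket1zE !dag_col2 [X in X * _]mxE [X in _ + X * _]mxE.
rewrite conjc1 conjc0; move: a; apply: ord2P => /=; rewrite mul1r mul0r.
  by rewrite addr0 phi_0E.
by rewrite add0r.
Qed.

(** Alice's bit [a] selects [phi R a] on the transmitted qubit, and cyclicity of the trace gathers
    both operators in one form. *)
Lemma ptrE_Psi (A B : 'M[C]_2) a :
  ptrE ((1%:M *t A) *m (Psi R *m dag (Psi R)) *m (1%:M *t B)) a a =
  (dag (phi R a) *m B *m A *m phi R a) 0 0.
Proof.
rewrite (mulmxA _ (Psi R)) -(mulmxA _ (dag (Psi R))).
rewrite -(mulmxA (dag (phi R a) *m B) A (phi R a)) mxE [RHS]mxE.
by apply: eq_bigr => e _; rewrite mxE big_ord1 tens_Psi Psi_tens mulrC.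
Qed.

(** * Diagonal entries of the joint state *)

Lemma dag_Rot : dag (Rot R) = (Rot R)^-1.
Proof. by rewrite RotVE RotE dag_mx2 conjN conj_sqrt2V. Qed.

Lemma dagK m n (A : 'M[C]_(m, n)) : dag (dag A) = A.
Proof. by apply/matrixP => i j; rewrite !mxE conjcK. Qed.

Lemma dag_RotX k : dag (Rot R ^+ k) = Rot R ^- k.
Proof.
rewrite -exprVn -dag_Rot; elim: k => [|k IH].
  by rewrite !expr0 /dag map_mx1 trmx1.
by rewrite exprSr exprS -IH; exact: dagM.
Qed.

(** Unnormalized probability of bits [a], [b] under rotation [k]: Eve's outcome [A] on Alice's
    rotated state, times Bob's filtering of the resent [v]. *)
Definition gain (A : 'M[C]_2) (v : 'cV[C]_2) (a b : 'I_2) (k : nat) : C :=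
  let u := Rot R ^+ k *m phi R a in
  let f := (Filt R *m Rot R ^- k *m v) b 0 in
  (dag u *m A *m u) 0 0 * (f * conjc f).

Lemma rhoAB_diag J (M : 'I_J -> 'M[C]_2) (sigma : 'I_J -> 'cV[C]_2) a b :
  rhoAB M sigma (mxtens_index (a, b)) (mxtens_index (a, b)) =
  \sum_(i < J) \sum_(k < 4) gain (M i) (sigma i) a b k.
Proof.
rewrite /rhoAB exchange_big summxE; apply: eq_bigr => i _; rewrite summxE.
apply: eq_bigr => k _; rewrite tensmxE /gain; congr (_ * _).
  rewrite tensmx_mul mulmx1 ptrE_Psi (mulmxA _ (M i)) dagM dag_RotX.
  by rewrite -[LHS](congr1 (fun B : 'M_1 => B 0 0) (mulmxA _ _ (phi R a))).
set F := Filt R; set K := Rot R ^+ k.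
(* Unitarity of the rotation makes Bob's factor a rank-one operator, whose diagonal entries are
   squared moduli. *)
have -> : F *m K^-1 *m (sigma i *m dag (sigma i)) *m K *m dag F =
    (F *m K^-1 *m sigma i) *m dag (F *m K^-1 *m sigma i).
  by rewrite !dagM -dag_RotX dagK !mulmxA.
by rewrite mxE big_ord1 [X in _ * X]mxE [X in _ * X]mxE.
Qed.

(** * Real directions and their rotations *)

Lemma quad_col2 (A : 'M[C]_2) x y :
  (dag (col2 x y) *m A *m col2 x y) 0 0 =
  conjc x * x * A 0 0 + conjc x * y * A 0 1 + conjc y * x * A 1 0 +
  conjc y * y * A 1 1.
Proof. by rewrite dag_col2 !mxE !sum_ord2 !mxE !sum_ord2 !mxE /=; ring. Qed.

Lemma Rot_col2 x y : Rot R *m col2 x y = col2 (h * x + h * y) (h * y - h * x).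
Proof. by rewrite RotE mul_mx2_col2; congr col2; ring. Qed.

(* (dirX n, dirY n) is the n-th image of (- sin8, cos8) under Rot.  Up to the
   factor sqrt2V for Bob, every vector in the protocol is one of these real
   directions: see Rot_phi for Alice and Filt_Rot for Bob. *)
Definition dirX (n : nat) : C := [:: - s; s; c; c; s; - s; - c]`_n.
Definition dirY (n : nat) : C := [:: c; c; s; - s; - c; - c; - s]`_n.

(** The bound keeps [n.+1] among the seven listed entries, past which [nth] returns 0. *)
Lemma dirS n : (n < 6)%N ->
  h * dirX n + h * dirY n = dirX n.+1 /\ h * dirY n - h * dirX n = dirY n.+1.
Proof.
rewrite /dirX /dirY; case: n => [|[|[|[|[|[|//]]]]]] _; split;
  rewrite [LHS]/= [RHS]/=;
  solve [rewrite -[in RHS]sin8E; ring | rewrite -[in RHS]cos8E; ring].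
Qed.

Lemma conj_dir n : (n < 7)%N ->
  conjc (dirX n) = dirX n /\ conjc (dirY n) = dirY n.
Proof.
by rewrite /dirX /dirY; case: n => [|[|[|[|[|[|[|//]]]]]]] _;
  split; rewrite [nth _ _ _]/= ?conjN ?conj_cos8 ?conj_sin8.
Qed.

(** [phi R 0] is direction 2 and [phi R 1] direction 1; each rotation advances the index by one. *)
Lemma Rot_phi (a : 'I_2) k : (k < 4)%N ->
  Rot R ^+ k *m phi R a = col2 (dirX (k + 2 - a)) (dirY (k + 2 - a)).
Proof.
have e0 : phi R a = col2 (dirX (2 - a)) (dirY (2 - a)).
  by move: a; apply: ord2P; [rewrite phi_0E phi0E | rewrite phi1E].
elim: k => [_|k IH ltk]; first exact: etrans (mul1mx _) e0.
rewrite exprS -(mulmxA _ _ (phi R a)) IH ?(ltnW ltk) // Rot_col2.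
(* Ensures that the truncated subtraction commutes with the successor. *)
have la : (a <= k + 2)%N by rewrite addn2 -ltnS (leq_trans (ltn_ord a)).
have [|-> ->] := @dirS (k + 2 - a); first by lia.
by rewrite addSn subSn.
Qed.

Lemma mul_mx2_RotV x y z w : mx2 (h * x) (h * y) (h * z) (h * w) * (Rot R)^-1 =
  mx2 (h * (h * x + h * y)) (h * (h * y - h * x))
      (h * (h * z + h * w)) (h * (h * w - h * z)).
Proof. by rewrite RotVE mul_mx2; congr mx2; ring. Qed.

(** The rows of [Filt] are directions 3 and 0 up to [h]. As [Rot] is orthogonal, its inverse acting
    on rows from the right advances them as [Rot] advances columns. *)
Lemma Filt_Rot k : (k < 4)%N ->
  Filt R *m Rot R ^- k =
  mx2 (h * dirX (k + 3)) (h * dirY (k + 3)) (h * dirX k) (h * dirY k).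
Proof.
elim: k => [_|k IH ltk].
  rewrite expr0 invr1 [LHS]mulr1 FiltE.
  by congr mx2; rewrite /dirX /dirY [RHS]/=; ring.
have -> : Filt R *m Rot R ^- k.+1 = (Filt R *m Rot R ^- k) * (Rot R)^-1.
  by rewrite -!exprVn exprSr [LHS]mulrA.
rewrite IH ?(ltnW ltk) // mul_mx2_RotV addSn.
have [|-> ->] := @dirS (k + 3); first by lia.
by have [|-> ->] := @dirS k; first by lia.
Qed.

(** * Sums over the four rotations *)

Definition dir_gain (A : 'M[C]_2) (v : 'cV[C]_2) (n m : nat) : C :=
  (dirX n * dirX n * A 0 0 + dirX n * dirY n * (A 0 1 + A 1 0) +
   dirY n * dirY n * A 1 1) *
  (h * h * (dirX m * dirX m * (v 0 0 * conjc (v 0 0)) +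
    dirX m * dirY m * (v 0 0 * conjc (v 1 0) + v 1 0 * conjc (v 0 0)) +
    dirY m * dirY m * (v 1 0 * conjc (v 1 0)))).

(** Real directions see only symmetric combinations of off-diagonal entries, so the Y components
    drop out. The offset [3 * (1 - b)] picks the row of [Filt_Rot]. *)
Lemma gainE A v (a b : 'I_2) k : (k < 4)%N ->
  gain A v a b k = dir_gain A v (k + 2 - a) (k + 3 * (1 - b)).
Proof.
move=> ltk; rewrite /gain /dir_gain Rot_phi // quad_col2.
have [|-> ->] := @conj_dir (k + 2 - a); first lia.
have [|eg el] := @conj_dir (k + 3 * (1 - b)); first lia.
set g := dirX _ in eg *; set l := dirY _ in el *.
have -> : (Filt R *m Rot R ^- k *m v) b 0 = h * g * v 0 0 + h * l * v 1 0.
  rewrite Filt_Rot // mxE sum_ord2 !mxE.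
  by rewrite /g /l; move: b {eg el g l}; apply: ord2P; rewrite /= ?addn0.
rewrite !(conjD, conjM) conj_sqrt2V eg el; ring.
Qed.

(* If A = t I + u . (Z, X, Y) and v has squared norm p and unnormalized Bloch
   vector r, then weight = 2 t p and overlap = 2 (u_Z r_Z + u_X r_X). *)
Definition weight (A : 'M[C]_2) (v : 'cV[C]_2) : C :=
 (A 0 0 + A 1 1) * (v 0 0 * conjc (v 0 0) + v 1 0 * conjc (v 1 0)).

Definition overlap (A : 'M[C]_2) (v : 'cV[C]_2) : C :=
 (A 0 0 - A 1 1) * (v 0 0 * conjc (v 0 0) - v 1 0 * conjc (v 1 0)) +
 (A 0 1 + A 1 0) * (v 0 0 * conjc (v 1 0) + v 1 0 * conjc (v 0 0)).

Lemma dirE :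
  ((dirX 0 = - s) * (dirY 0 = c) * (dirX 1 = s) * (dirY 1 = c) *
   (dirX 2 = c) * (dirY 2 = s) * (dirX 3 = c) * (dirY 3 = - s) *
   (dirX 4 = s) * (dirY 4 = - c) * (dirX 5 = - s) * (dirY 5 = - c) *
   (dirX 6 = - c) * (dirY 6 = - s))%type.
Proof. by []. Qed.

Lemma sum_gain A v (a b : 'I_2) :
  let g k := dir_gain A v (k + 2 - a) (k + 3 * (1 - b)) in
  \sum_(k < 4) gain A v a b k = g 0%N + g 1%N + g 2%N + g 3%N.
Proof.
move=> g; rewrite -sum_ord4; apply: eq_bigr => k _; exact: gainE.
Qed.

(** For unequal bits the two directions are two steps apart, hence opposite on the Bloch circle.
    Terms linear in a direction cancel over the four rotations, and the product of the linear parts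
    leaves the overlap with a minus sign. *)
Lemma gain_error A v :
  \sum_(k < 4) gain A v 0 1 k + \sum_(k < 4) gain A v 1 0 k =
  weight A v - overlap A v / 2.
Proof.
have [c2 s2 cs h2] := cos8_sin8_quadratic.
set g := dir_gain A v.
transitivity (g 2%N 0%N + g 3%N 1%N + g 4%N 2%N + g 5%N 3%N +
  (g 1%N 3%N + g 2%N 4%N + g 3%N 5%N + g 4%N 6%N)).
  by congr (_ + _); exact: sum_gain.
(* As a free variable, e = 1/2 lets ring reduce powers of h without division. *)
have [e hh] : exists e, h * h = e by exists (h * h).
rewrite /g /dir_gain !dirE !mulrNN !(mulNr, mulrN) (mulrC s c) c2 s2 cs.
(* At [e = 1/2] the coefficients are 1 and 1/2; the extra [e] is the product of the two terms linear
   in [h]. *)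
transitivity (8 * e * e * e * weight A v - 8 * e * e * e * e * overlap A v).
  by rewrite /weight /overlap; ring: hh.
have -> : e = 2^-1.
  by apply: (@mulfI _ 2); rewrite ?pnatr_eq0 // divff ?pnatr_eq0 // -hh.
by field.
Qed.

(** For equal bits the directions are one step apart, perpendicular on the Bloch circle, with Bob
    ahead for bit 0 and behind for bit 1. The two antisymmetric contributions cancel, so no overlap
    remains. *)
Lemma gain_correct A v :
  \sum_(k < 4) gain A v 0 0 k + \sum_(k < 4) gain A v 1 1 k = weight A v.
Proof.
have [c2 s2 cs h2] := cos8_sin8_quadratic.
set g := dir_gain A v.
transitivity (g 2%N 3%N + g 3%N 4%N + g 4%N 5%N + g 5%N 6%N +
  (g 1%N 0%N + g 2%N 1%N + g 3%N 2%N + g 4%N 3%N)).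
  by congr (_ + _); exact: sum_gain.
have [e hh] : exists e, h * h = e by exists (h * h).
rewrite /g /dir_gain !dirE !mulrNN !(mulNr, mulrN) (mulrC s c) c2 s2 cs.
transitivity (8 * e * e * e * weight A v).
  by rewrite /weight; ring: hh.
have -> : e = 2^-1.
  by apply: (@mulfI _ 2); rewrite ?pnatr_eq0 // divff ?pnatr_eq0 // -hh.
by field.
Qed.

(** * Trace and bit error rate in terms of weight and overlap *)

Lemma trace_rhoAB J (M : 'I_J -> 'M[C]_2) (sigma : 'I_J -> 'cV[C]_2) :
  \tr (rhoAB M sigma) =
  \sum_i (2 * weight (M i) (sigma i) - overlap (M i) (sigma i) / 2).
Proof.
have swap (p q r t : C) : p + q + (r + t) = p + t + (q + r) by ring.
pose S a b := \sum_i \sum_(k < 4) gain (M i) (sigma i) a b k.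
(* Equal bits are grouped apart from unequal ones, to match the two averages. *)
transitivity (S 0 0 + S 1 1 + (S 0 1 + S 1 0)).
  transitivity (S 0 0 + S 0 1 + (S 1 0 + S 1 1)); last exact: swap.
  rewrite tens_diag_trace !sum_ord2.
  by congr (_ + _ + (_ + _)); exact: rhoAB_diag.
rewrite -!big_split; apply: eq_bigr => i _.
rewrite [X in X + _ = _]gain_correct [X in _ + X = _]gain_error; ring.
Qed.

Lemma ebit_rhoAB J (M : 'I_J -> 'M[C]_2) (sigma : 'I_J -> 'cV[C]_2) :
  ebit (rhoAB M sigma) =
  (\sum_i (weight (M i) (sigma i) - overlap (M i) (sigma i) / 2)) /
  \tr (rhoAB M sigma).
Proof.
rewrite /ebit; congr (_ / _).
transitivity (rhoAB M sigma (mxtens_index (0, 1)) (mxtens_index (0, 1)) +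
  rhoAB M sigma (mxtens_index (1, 0)) (mxtens_index (1, 0))).
  rewrite /ket0z /ket1z (ket_tens 0 1) (ket_tens 1 0).
  by congr (_ + _); exact: braket_delta.
pose S a b := \sum_i \sum_(k < 4) gain (M i) (sigma i) a b k.
transitivity (S 0 1 + S 1 0); first by congr (_ + _); exact: rhoAB_diag.
by rewrite -big_split; apply: eq_bigr => i _; exact: gain_error.
Qed.

(** * Positivity of Eve's operators *)

Lemma psd_overlap_le_weight A v : psd A -> 0 <= weight A v - overlap A v.
Proof.
(* The forms at the orthogonal complements of v and of its conjugate differ
   only in the sign of the Y component of A, which cancels in their sum. *)
move=> A0; have := A0 (col2 (- v 1 0) (v 0 0)).
have := A0 (col2 (- conjc (v 1 0)) (conjc (v 0 0))).
rewrite !quad_col2 !conjN !conjcK => p q; apply: le_trans (addr_ge0 p q) _.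
by rewrite le_eqVlt; apply/orP; left; apply/eqP; rewrite /weight /overlap; ring.
Qed.

Lemma cV2E (v : 'cV[C]_2) : v = col2 (v 0 0) (v 1 0).
Proof. by apply/matrixP; apply: ord2P => i; rewrite ord1 !mxE. Qed.

Lemma psd_diag (x y : C) : 0 <= x -> 0 <= y -> psd (mx2 x 0 0 y).
Proof.
move=> x0 y0 v; rewrite [v]cV2E quad_col2 !mxE !eqxx /= !mulr0 !addr0.
by rewrite addr_ge0 // mulr_ge0 // mulrC mul_conjC_ge0.
Qed.

End Attack.

(* The smallest bit error rate Eve can induce is 1/3: it is a lower bound
   over all POVM attacks (with Tr rho_AB > 0) and it is attained. *)
Theorem theorem4 (R : realType) :
  (forall (J : nat) (Mvac : 'M[R[i]]_2) (M : 'I_J -> 'M[R[i]]_2)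
          (sigma : 'I_J -> 'cV[R[i]]_2),
      is_povm Mvac M -> (forall i, is_state (sigma i)) ->
      0 < \tr (rhoAB M sigma) ->
      3%:R^-1 <= ebit (rhoAB M sigma))
  /\
  (exists (J : nat) (Mvac : 'M[R[i]]_2) (M : 'I_J -> 'M[R[i]]_2)
          (sigma : 'I_J -> 'cV[R[i]]_2),
      [/\ is_povm Mvac M, (forall i, is_state (sigma i)),
          0 < \tr (rhoAB M sigma) &
          ebit (rhoAB M sigma) = 3%:R^-1]).
Proof.
split=> [J Mvac M sigma [_ [M0 _]] _ tr0|].
  rewrite ebit_rhoAB ler_pdivlMr // mulrC ler_pdivrMr ?ltr0n // -subr_ge0.
  rewrite trace_rhoAB mulr_suml -sumrB; apply: sumr_ge0 => i _.
  (* For each outcome, three times the error term minus the trace term is exactly weight minus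
     overlap. *)
  apply: le_trans (psd_overlap_le_weight (sigma i) (M0 i)) _.
  by rewrite le_eqVlt; apply/orP; left; apply/eqP; field.
(* The complementary projector will serve as the vacuum outcome. The kept projector annihilates the
   complement of the resent state, so weight equals overlap, and the rate is 1/2 over 3/2. *)
pose M (_ : 'I_1) : 'M[R[i]]_2 := mx2 1 0 0 0.
pose sigma (_ : 'I_1) : 'cV[R[i]]_2 := col2 1 0.
have [w o] : weight (M 0) (sigma 0) = 1 /\ overlap (M 0) (sigma 0) = 1.
  by rewrite /weight /overlap !mx2E !col2E conjc0 conjc1; split; ring.
have tr : \tr (rhoAB M sigma) = 3 / 2.
  by rewrite trace_rhoAB big_ord1 w o; field.
exists 1, (mx2 0 0 0 1), M, sigma; split.
- split; first exact: psd_diag.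
  split=> [i|]; first exact: psd_diag.
  rewrite big_ord1; apply/matrixP; apply: ord2P; apply: ord2P;
    by rewrite !mxE /= ?addr0 ?add0r.
- move=> i; rewrite /is_state dag_col2 mxE sum_ord2 !col2E !mxE conjc1 /=; ring.
- by rewrite tr divr_gt0 ?ltr0n.
by rewrite ebit_rhoAB tr big_ord1 w o; field.
Qed.
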